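(* Let $n\ge 4$ and let $\alpha\in IOF_n^{par}$ be neither a partial identity nor the empty map. Let $w_\alpha$ be the word over the alphabet $X_n=\{v_1,\dots,v_n,u_1,\dots,u_{n-2},x_1,\dots,x_{n-2}\}$ constructed from $\alpha$ as described in the context, and let $\overline{w}_\alpha$ be the transformation obtained from $w_\alpha$ by replacing each letter $a$ by the transformation $\overline{a}$. Then $\alpha=\overline{w}_\alpha$.
   Context: Let $\overline{n}=\{1,\dots,n\}$. $I_n$ is the symmetric inverse monoid of all partial injections of $\overline{n}$ (including the empty map), maps written on the right and composed left to right. The fence on $\overline{n}$ is $1\prec 2\succ 3\prec 4\succ\cdots$, i.e. $x\prec y$ iff $x$ is odd, $y$ is even and $|x-y|=1$. A map $\alpha\in I_n$ is fence-preserving if $x\prec y$ implies $x\alpha\prec y\alpha$ for all $x,y\in dom(\alpha)$; $PFI_n$ is the monoid of all fence-preserving $\alpha\in I_n$. $IOF_n^{par}$ is the set of all $\alpha\in PFI_n$ that are regular in $PFI_n$ (equivalently, $\alpha^{-1}\in PFI_n$), order-preserving ($x<y$ implies $x\alpha<y\alpha$ for $x,y\in dom(\alpha)$) and parity-preserving ($x$ and $x\alpha$ have the same parity for all $x\in dom(\alpha)$). Transformations attached to letters: for $i\in\{1,\dots,n\}$, $\overline{v}_i$ is the partial identity with domain $\overline{n}\setminus\{i\}$. For $i\in\{1,\dots,n-2\}$, $\overline{u}_i$ has domain $\{1,\dots,i\}\cup\{i+4,\dots,n\}$ (second set empty if $i+4>n$), with $\rho\,\overline{u}_i=\rho+2$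 for $\rho\le i$ and $\rho\,\overline{u}_i=\rho$ for $\rho\ge i+4$; and $\overline{x}_i=(\overline{u}_i)^{-1}$. Words: for a word $z=a_1\cdots a_k$ over $X_n$ put $z^{-1}=a_ka_{k-1}\cdots a_1$ (reversal). For $i\in\{1,\dots,n-2\}$ and $j\in\{1,\dots,\lfloor (n-i)/2\rfloor\}$ put $x_{i,j}=x_ix_{i+2}\cdots x_{i+2j-2}$ and $u_{i,j}=u_iu_{i+2}\cdots u_{i+2j-2}$. $W_x$ and $W_u$ denote the sets of all words $x_{i,j}$, respectively $u_{i,j}$. Construction of $w_\alpha$. Write $dom(\alpha)=\{d_1<\dots<d_p\}$ and $m_i=d_i\alpha$. Let $r_1<\dots<r_l$ (with $l\ge 0$) be exactly the indices $i\in\{1,\dots,p-1\}$ with $d_{i+1}-d_i\ne m_{i+1}-m_i$, and put $r_{l+1}=p$. For $i\in\{1,\dots,l\}$, with $M=m_{r_i+1}-m_{r_i}$ and $D=d_{r_i+1}-d_{r_i}$, put $w_i=x_{m_{r_i},(M-D)/2}$ if $M>D$ and $w_i=u_{d_{r_i},(D-M)/2}$ if $M<D$. Put $w_{l+1}=x_{m_p,(d_p-m_p)/2}$ if $d_p>m_p$, $w_{l+1}=u_{d_p,(m_p-d_p)/2}$ if $d_p<m_p$, and $w_{l+1}$ the empty word if $d_p=m_p$. Let $s_1<\dots<s_a$ be the indices $k\in\{1,\dots,l+1\}$ with $w_k\in W_u$ and let $s_{a+1}>\dots>s_{a+b}$ be the indices $k$ with $w_k\in W_x$ (listed decreasingly;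 $a,b\ge 0$). Put $$w_\alpha^*=w_{s_1}\cdots w_{s_a}\,w_{s_{a+1}}^{-1}\cdots w_{s_{a+b}}^{-1}.$$ Define words $\lambda_0,\dots,\lambda_p$ as follows. Definition of $\lambda_0$: $\lambda_0=v_{d_p+2}\cdots v_n w_\alpha^*$ if $d_p\le n-2$ and $m_p<d_p$; $\lambda_0=v_{m_p+2}\cdots v_nw_\alpha^*$ if $d_p\le n-2$ and $d_p<m_p<n-1$; $\lambda_0=v_{m_p+1}\cdots v_nw_\alpha^*$ if $d_p\le n-2$ and $m_p=d_p$; $\lambda_0=v_nw_\alpha^*$ if $d_p=m_p=n-1$; and $\lambda_0=w_\alpha^*$ in all other cases. For $k=p,p-1,\dots,2$, with $M=m_k-m_{k-1}$ and $D=d_k-d_{k-1}$: $\lambda_{p-k+1}=v_{d_{k-1}+1}\cdots v_{d_k-1}\lambda_{p-k}$ if $2\le M=D$; $\lambda_{p-k+1}=v_{d_k-(M-2)}\cdots v_{d_k-1}\lambda_{p-k}$ if $2<M<D$; $\lambda_{p-k+1}=v_{d_{k-1}+2}\cdots v_{d_k-1}\lambda_{p-k}$ if $M>D>2$; and $\lambda_{p-k+1}=\lambda_{p-k}$ otherwise. Finally, $\lambda_p=\lambda_{p-1}$ if $d_1=1$ or $m_1=1$; $\lambda_p=v_1\cdots v_{d_1-1}\lambda_{p-1}$ if $1<d_1\le m_1$; $\lambda_p=v_{d_1-m_1+1}\cdots v_{d_1-1}\lambda_{p-1}$ if $1<m_1<d_1$. Put $w_\alpha=\lambda_p$. *)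

(* Defs.v *)
(* The set {1, ..., n} is carried by 'I_n, the ordinal x
   standing for the number lbl x = x.+1; domains, images, word indices and
   letter indices below are all expressed with these 1-based numbers. *)
From HB Require Import structures.
From mathcomp Require Import all_boot.

Set Implicit Arguments.
Unset Strict Implicit.
Unset Printing Implicit Defensive.

Definition lbl n (x : 'I_n) : nat := x.+1.

(* Partial transformations; None means "undefined". *)
Definition ptrans n := {ffun 'I_n -> option 'I_n}.

Definition pid n : ptrans n := [ffun x => Some x].
Definition pempty n : ptrans n := [ffun=> None].

(* Maps are written on the right: pcomp a b is "first a, then b". *)
Definition pcomp n (a b : ptrans n) : ptrans n := [ffun x => obind b (a x)].

(* The inverse partial map, when a is injective on its domain. *)
Definition pinv n (a : ptrans n) : ptrans n :=
  [ffun y => [pick x | a x == Some y]].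

Definition partial_identity n (a : ptrans n) : Prop :=
  forall x y, a x = Some y -> y = x.

Definition symmetric_inverse n (a : ptrans n) : Prop :=
  forall x y z, a x = Some z -> a y = Some z -> x = y.

Definition fence (x y : nat) : bool :=
  [&& odd x, ~~ odd y & (x == y.+1) || (y == x.+1)].

Definition fence_preserving n (a : ptrans n) : Prop :=
  forall x y x' y', a x = Some x' -> a y = Some y' ->
    fence (lbl x) (lbl y) -> fence (lbl x') (lbl y').

Definition PFI n (a : ptrans n) : Prop :=
  symmetric_inverse a /\ fence_preserving a.

Definition regular_in n (S : ptrans n -> Prop) (a : ptrans n) : Prop :=
  exists2 b, S b & pcomp (pcomp a b) a = a.

Definition order_preserving n (a : ptrans n) : Prop :=
  forall x y x' y', a x = Some x' -> a y = Some y' ->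
    lbl x < lbl y -> lbl x' < lbl y'.

Definition parity_preserving n (a : ptrans n) : Prop :=
  forall x x', a x = Some x' -> odd (lbl x) = odd (lbl x').

Definition IOFpar n (a : ptrans n) : Prop :=
  [/\ PFI a, regular_in (@PFI n) a, order_preserving a & parity_preserving a].

Inductive letter := V of nat | U of nat | X of nat.

Definition letter_code (l : letter) : nat + (nat + nat) :=
  match l with V i => inl i | U i => inr (inl i) | X i => inr (inr i) end.
Definition letter_decode (c : nat + (nat + nat)) : letter :=
  match c with inl i => V i | inr (inl i) => U i | inr (inr i) => X i end.
Lemma letter_codeK : cancel letter_code letter_decode.
Proof. by case. Qed.
HB.instance Definition _ := Equality.copy letter (can_type letter_codeK).

Definition alphabet n (l : letter) : bool :=
  match l with
  | V i => 1 <= i <= n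
  | U i | X i => 1 <= i <= n - 2
  end.

Definition vbar n (i : nat) : ptrans n :=
  [ffun x => if lbl x == i then None else Some x].

(* For i <= n - 2 the partial projection insub is defined where it is used:
   it returns the element labelled lbl x + 2. *)
Definition ubar n (i : nat) : ptrans n :=
  [ffun x : 'I_n => if lbl x <= i then insub x.+2
                    else if i + 4 <= lbl x then Some x else None].

Definition xbar n (i : nat) : ptrans n := pinv (ubar n i).

(* Only meaningful for letters satisfying alphabet n. *)
Definition letter_bar n (l : letter) : ptrans n :=
  match l with V i => vbar n i | U i => ubar n i | X i => xbar n i end.

Definition word_bar n (w : seq letter) : ptrans n :=
  foldr (fun l b => pcomp (letter_bar n l) b) (pid n) w.

Definition xword (i j : nat) : seq letter := [seq X (i + 2 * t) | t <- iota 0 j].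
Definition uword (i j : nat) : seq letter := [seq U (i + 2 * t) | t <- iota 0 j].

Definition Wx n : seq (seq letter) :=
  [seq xword i j | i <- iota 1 (n - 2), j <- iota 1 ((n - i) %/ 2)].
Definition Wu n : seq (seq letter) :=
  [seq uword i j | i <- iota 1 (n - 2), j <- iota 1 ((n - i) %/ 2)].

(* v_i v_(i+1) ... v_j, with both ends included. *)
Definition vrange (i j : nat) : seq letter := [seq V k | k <- index_iota i j.+1].

(* In this section d k and m k, for 1 <= k <= p, are d_k and m_k.  Both are
   increasing in k for an order-preserving map, and each subtraction below is
   used only where it does not truncate. *)
Section Words.
Context (n p : nat) (d m : nat -> nat).

Definition breaks : seq nat :=
  [seq i <- iota 1 p.-1 | d i.+1 - d i != m i.+1 - m i].

Definition wbreak (r : nat) : seq letter :=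
  let M := m r.+1 - m r in let D := d r.+1 - d r in
  if D < M then xword (m r) ((M - D) %/ 2) else uword (d r) ((D - M) %/ 2).

Definition wlast : seq letter :=
  if m p < d p then xword (m p) ((d p - m p) %/ 2)
  else if d p < m p then uword (d p) ((m p - d p) %/ 2)
  else [::].

Definition wlist : seq (seq letter) := rcons (map wbreak breaks) wlast.

Definition wstar : seq letter :=
  flatten [seq w <- wlist | w \in Wu n]
  ++ flatten [seq rev w | w <- rev [seq w <- wlist | w \in Wx n]].

Definition lambda0 : seq letter :=
  if (d p <= n - 2) && (m p < d p) then vrange (d p + 2) n ++ wstar
  else if (d p <= n - 2) && (d p < m p < n - 1) then vrange (m p + 2) n ++ wstar
  else if (d p <= n - 2) && (m p == d p) then vrange (m p + 1) n ++ wstar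
  else if (d p == m p) && (m p == n - 1) then V n :: wstar
  else wstar.

Definition gap_prefix (k : nat) : seq letter :=
  let M := m k - m k.-1 in let D := d k - d k.-1 in
  if (2 <= M) && (M == D) then vrange (d k.-1 + 1) (d k - 1)
  else if 2 < M < D then vrange (d k - (M - 2)) (d k - 1)
  else if 2 < D < M then vrange (d k.-1 + 2) (d k - 1)
  else [::].

(* lambda t is lambda_t for 0 <= t <= p - 1; lambda_(t+1) = lambda_(p-k+1)
   is obtained at k = p - t. *)
Fixpoint lambda (t : nat) : seq letter :=
  if t is t'.+1 then gap_prefix (p - t') ++ lambda t' else lambda0.

Definition first_prefix : seq letter :=
  if (d 1 == 1) || (m 1 == 1) then [::]
  else if 1 < d 1 <= m 1 then vrange 1 (d 1 - 1)
  else if 1 < m 1 < d 1 then vrange (d 1 - m 1 + 1) (d 1 - 1)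
  else [::].

Definition lambda_last : seq letter := first_prefix ++ lambda p.-1.

End Words.

(* The graph of a, as pairs of numbers, by increasing first component. *)
Definition graph n (a : ptrans n) : seq (nat * nat) :=
  pmap (fun x => omap (fun y => (lbl x, lbl y)) (a x)) (enum 'I_n).

Definition w_word n (a : ptrans n) : seq letter :=
  lambda_last n (size (graph a))
    (fun k => nth 0 (unzip1 (graph a)) k.-1)
    (fun k => nth 0 (unzip2 (graph a)) k.-1).

(* Main.v *)
(* The word w_alpha consists of letters v_i followed by w*_alpha.  In w*_alpha the
   letters u move the points d_1 < ... < d_p upwards to points c_1 < ... < c_p
   with c_(k+1) - c_k = min(d_(k+1) - d_k, m_(k+1) - m_k).  The definition of c is
   symmetric in d and m, and the letters x of w*_alpha spell, in inverted form, the
   map sending m_1, ..., m_p to c_1, ..., c_p in the same way; hence w*_alpha sends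
   d_k to m_k.  A point in a gap of the domain is sent by w*_alpha into the
   corresponding gap of the image, so it is either already removed by w*_alpha or one
   of the points removed by the letters v_i.  Two sentinels d_(p+1) = m_(p+1) = n + 2
   let the points above d_p be treated as those in any other gap. *)
Require Import Defs.
From mathcomp Require Import all_boot zify.

Set Implicit Arguments.
Unset Strict Implicit.
Unset Printing Implicit Defensive.

(** * Action of letters and words on natural numbers *)

(** Numbers replace ordinals and [n] disappears, so that computations become linear arithmetic.
    [X i] is undefined at 1 and 2 because [U i] sends positive numbers to numbers above 2. *)
Definition act_letter (l : letter) (x : nat) : option nat :=
  match l with
  | V i => if x == i then None else Some x
  | U i => if x <= i then Some x.+2 else if i + 4 <= x then Some x else None
  | X i => if x <= 2 then None else if x <= i + 2 then Some (x - 2)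
           else if i + 4 <= x then Some x else None
  end.

Fixpoint act (w : seq letter) (x : nat) : option nat :=
  if w is l :: w' then obind (act w') (act_letter l x) else Some x.

Lemma act_cat w1 w2 x : act (w1 ++ w2) x = obind (act w2) (act w1 x).
Proof. by elim: w1 x => //= l w1 IH x; case: (act_letter l x) => //=. Qed.

(** Partial identities only delete points, so the order and the repetitions of the letters in [w1]
    are irrelevant. *)
Lemma act_V w1 w2 x : {in w1, forall l, exists i, l = V i} ->
  act (w1 ++ w2) x = if V x \in w1 then None else act w2 x.
Proof.
elim: w1 => //= l w1 IH Vw1.
have [i ->] := Vw1 l (mem_head _ _).
have {}IH : act (w1 ++ w2) x = if V x \in w1 then None else act w2 x.
  by apply: IH => l' l'w1; apply: Vw1; rewrite inE l'w1 orbT.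
rewrite inE /=; have -> : (V x == V i) = (x == i) by apply/eqP/eqP => [[]|->].
by case: (x == i).
Qed.

Lemma omap_lbl_inj n : injective (omap (@lbl n)).
Proof. by move=> [x|] [y|] //= [xy]; congr Some; apply: val_inj. Qed.

(** The bound [i <= n - 2] keeps the shifted point in range, so [insub] succeeds; for [xbar] the
    point found by [pick] is the unique preimage. *)
Lemma letter_barE n l (x : 'I_n) : alphabet n l ->
  omap (@lbl n) (letter_bar n l x) = act_letter l (lbl x).
Proof.
have ubarE i (z : 'I_n) : 0 < i <= n - 2 ->
    omap (@lbl n) (ubar n i z) = act_letter (U i) (lbl z).
  move=> Hi; rewrite /ubar ffunE /=; case: ifP => Hz; last by case: ifP.
  have Hz2 : z.+2 < n by move: Hz; rewrite /lbl; lia.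
  by rewrite insubT.
case: l => i /= Hi; first by rewrite /vbar ffunE; case: ifP.
  exact: (ubarE i).
rewrite /xbar /pinv ffunE; case: pickP => [y /eqP Hy|Hno] /=.
  move: (ubarE i y Hi); rewrite Hy /=.
  have y0 : 0 < lbl y by [].
  move: (lbl x) (lbl y) y0 => x' y' y0.
  by do ![case: ifP => //= ?]; case=> ?; try congr Some; lia.
case Ez: (act_letter (X i) (lbl x)) => [z|] //=.
have [z1 zn] : 0 < z /\ z.-1 < n.
  have xn : lbl x <= n by exact: ltn_ord.
  by move: (lbl x) xn Ez => x' xn /=; do ![case: ifP => //= ?]; case; lia.
suff /eqP: ubar n i (Ordinal zn) = Some x by rewrite Hno.
apply: omap_lbl_inj; rewrite ubarE // {1}/lbl [val _]/= prednK //.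
rewrite [omap _ (Some x)]/=; move: (lbl x) Ez => x' /=.
by do ![case: ifP => //= ?]; case=> ?; try congr Some; lia.
Qed.

Lemma word_barE n w (x : 'I_n) : all (alphabet n) w ->
  omap (@lbl n) (word_bar n w x) = act w (lbl x).
Proof.
elim: w x => [|l w IH] x /=; first by rewrite ffunE.
case/andP=> Hl Hw; rewrite /pcomp ffunE -letter_barE //.
by case: (letter_bar n l x) => //= y; apply: IH.
Qed.

(** * Inversion of words *)

Definition inv_letter (l : letter) : letter :=
  match l with V i => V i | U i => X i | X i => U i end.

Lemma act_inv_letter l x y : 0 < x -> 0 < y ->
  act_letter (inv_letter l) y = Some x <-> act_letter l x = Some y.
Proof.
case: l => i x0 y0 /=; split; do ![case: ifP => //= ?]; case=> ?;
  try congr Some; lia.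
Qed.

Lemma act_letter_gt0 l x y : 0 < x -> act_letter l x = Some y -> 0 < y.
Proof. by case: l => i x0 /=; do ![case: ifP => //= ?]; case=> ?; lia. Qed.

Lemma act_gt0 w x y : 0 < x -> act w x = Some y -> 0 < y.
Proof.
elim: w x => [x x0 [<-] //|l w IH x x0 /=].
by case El: (act_letter l x) => [z|] //=; apply/IH/(act_letter_gt0 x0 El).
Qed.

(** Positivity is preserved along a word, which keeps the computation away from 0, where [U i] and
    [X i] are not mutually inverse. *)
Lemma act_inv w x y : 0 < x -> 0 < y ->
  act (rev (map inv_letter w)) y = Some x <-> act w x = Some y.
Proof.
elim: w x => [x _ _|l w IH x x0 y0]; first by split=> -[->].
rewrite /= rev_cons -cats1 act_cat; split.
  case Ez: (act (rev _) y) => [z|] //=.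
  case El: (act_letter _ z) => [t|] //= [Et]; move: Et El => -> El.
  have z0 := act_gt0 y0 Ez.
  by move/(act_inv_letter l x0 z0): El => -> /=; apply/IH.
case El: (act_letter l x) => [z|] //= Ez.
have z0 := act_letter_gt0 x0 El.
move/(IH z z0 y0): Ez => -> /=.
by move/(act_inv_letter l x0 z0): El => ->.
Qed.

(** * Action of products of words over the letters u *)

Lemma uwordS i j : uword i j.+1 = U i :: uword i.+2 j.
Proof.
rewrite /uword /= muln0 addn0; congr cons.
by rewrite -[1]addn1 -[1]add0n addnC iotaDl -map_comp; apply: eq_map => t /=; congr U; lia.
Qed.

(** A point at most [i] stays below the indices, which grow by 2 as it does. A point above [i] must
    survive the last letter, of index [i + 2j - 2], whose domain resumes at [i + 2j + 2]. *)
Lemma act_uword i j x : act (uword i j) x =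
  if x <= i then Some (x + 2 * j)
  else if (j == 0) || (i + 2 * j + 2 <= x) then Some x else None.
Proof.
elim: j i x => [|j IH] i x.
  by rewrite muln0 addn0; case: ifP.
rewrite uwordS /=; have [xi|xi] := leqP x i.
  rewrite /= IH; have -> : x.+2 <= i.+2 by lia.
  by congr Some; lia.
have [xi4|xi4] := leqP (i + 4) x; last by rewrite ifF //; lia.
rewrite /= IH; have -> : (x <= i.+2) = false by lia.
by congr (if _ then _ else _); lia.
Qed.
(** The words attached to [l] consecutive gaps from [k] on; [shift] below is the total displacement
    of a point lying under all of them. *)
Definition ublock (d j : nat -> nat) k l : seq letter :=
  flatten [seq uword (d r) (j r) | r <- iota k l].

Definition shift (j : nat -> nat) k l : nat := sumn [seq 2 * j r | r <- iota k l].

Section ActUblock.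
Context (d j : nat -> nat) (k0 l0 : nat).
Context (d_inc : forall r, k0 <= r < k0 + l0 -> d r < d r.+1).
Context (d_gap : forall r, k0 <= r < k0 + l0 -> 0 < j r -> d r + 2 * j r + 2 <= d r.+1).

Lemma act_ublock_low k l x : k0 <= k -> k + l <= k0 + l0 -> x <= d k ->
  act (ublock d j k l) x = Some (x + shift j k l).
Proof.
elim: l k x => [|l IH] k x k0k kl xk; first by rewrite /shift /= addn0.
have kr : k0 <= k < k0 + l0 by lia.
rewrite /ublock /= act_cat act_uword xk /=.
move: (d_inc kr) (d_gap kr) => ik gk.
have -> : act (flatten [seq uword (d r) (j r) | r <- iota k.+1 l]) (x + 2 * j k)
   = Some (x + 2 * j k + shift j k.+1 l) by apply: IH; lia.
by rewrite /shift /= addnA.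
Qed.

Lemma ublock_homo a b : k0 <= a -> a <= b -> b <= k0 + l0 -> d a <= d b.
Proof.
move=> k0a; elim: b => [|b IH] ab bl; first by have -> : a = 0 by lia.
have [->//|{}ab] : a = b.+1 \/ a <= b by lia.
have br : k0 <= b < k0 + l0 by lia.
by have := d_inc br; have := IH ab; lia.
Qed.

(** Words of gaps before [r] fix [x], which lies beyond their holes; the word of gap [r] deletes or
    fixes it; the later words all shift it. *)
Lemma act_ublock_gap k l r x : k0 <= k -> k + l <= k0 + l0 ->
  k <= r < k + l -> d r < x <= d r.+1 ->
  act (ublock d j k l) x =
    if (0 < j r) && (x < d r + 2 * j r + 2) then None
    else Some (x + shift j r.+1 (k + l - r.+1)).
Proof.
elim: l k => [|l IH] k k0k kl kr xr; first by lia.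
have kr0 : k0 <= k < k0 + l0 by lia.
rewrite /ublock /= act_cat act_uword.
move: (d_inc kr0) (d_gap kr0) => ik gk.
have [Er|ltkr] : r = k \/ k < r by lia.
  rewrite {}Er in xr *; have -> : (x <= d k) = false by lia.
  have -> : (j k == 0) || (d k + 2 * j k + 2 <= x)
     = ~~ ((0 < j k) && (x < d k + 2 * j k + 2)) by lia.
  case: (_ && _) => //=.
  have -> : k + l.+1 - k.+1 = l by lia.
  by apply: act_ublock_low; lia.
have dr : d k.+1 <= d r by apply: ublock_homo; lia.
have -> : (x <= d k) = false by lia.
have -> : (j k == 0) || (d k + 2 * j k + 2 <= x) by lia.
rewrite /= -/(ublock d j k.+1 l) IH; [|lia..].
by have -> : k.+1 + l = k + l.+1 by lia.
Qed.

End ActUblock.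

Lemma shiftS j k p : k <= p ->
  shift j k (p.+1 - k) = 2 * j k + shift j k.+1 (p.+1 - k.+1).
Proof. by move=> kp; have -> : p.+1 - k = (p.+1 - k.+1).+1 by lia. Qed.

(** * Sentinels, gaps and the numerical form of the hypotheses on the map *)

(** With [n + 2] as sentinel, the last gap has length at least 2 for both sequences, and its defect
    is the exponent of the last word. *)
Definition ext (n p : nat) (f : nat -> nat) k := if k <= p then f k else n.+2.

Definition gap (n p : nat) (f : nat -> nat) k := ext n p f k.+1 - ext n p f k.

(* Subtraction truncates: defect n p d m k is the length of the word over the u_i at
   gap k, defect n p m d k that of the word over the x_i, at most one being nonzero. *)
Definition defect (n p : nat) (f g : nat -> nat) k :=
  (gap n p f k - gap n p g k) %/ 2.

(** The conditions are symmetric in [d] and [m], so every result on the letters u transfers to the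
    letters x. The field [fp_adj] expresses fence preservation by the map and its inverse. *)
Record fence_pair (n p : nat) (d m : nat -> nat) : Prop := {
  fp_p_gt0 : 0 < p;
  fp_d_gt0 : 0 < d 1;
  fp_m_gt0 : 0 < m 1;
  fp_d_le : d p <= n;
  fp_m_le : m p <= n;
  fp_d_inc : forall k, 0 < k < p -> d k < d k.+1;
  fp_m_inc : forall k, 0 < k < p -> m k < m k.+1;
  fp_odd : forall k, 0 < k <= p -> odd (d k) = odd (m k);
  fp_adj : forall k, 0 < k < p -> d k.+1 = (d k).+1 <-> m k.+1 = (m k).+1
}.

Lemma fence_pair_sym n p d m : fence_pair n p d m -> fence_pair n p m d.
Proof. by case=> *; split=> // *; [symmetry; auto | apply: iff_sym; auto]. Qed.

Lemma ext_in n p f k : k <= p -> ext n p f k = f k.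
Proof. by rewrite /ext => ->. Qed.

Lemma ext_out n p f : ext n p f p.+1 = n.+2.
Proof. by rewrite /ext ltnn. Qed.

Lemma extS n p d m k : fence_pair n p d m -> 0 < k <= p ->
  ext n p d k.+1 = ext n p d k + gap n p d k /\ 0 < gap n p d k.
Proof.
move=> H kp; suff: ext n p d k < ext n p d k.+1 by rewrite /gap; lia.
have [->|ltkp] : k = p \/ k < p by lia.
  by rewrite ext_out ext_in //; have := fp_d_le H; lia.
by rewrite !ext_in; [apply: (fp_d_inc H)| |]; lia.
Qed.

Lemma gap_parity n p d m k : fence_pair n p d m -> 0 < k <= p ->
  odd (gap n p d k) = odd (gap n p m k) /\ (gap n p d k = 1 <-> gap n p m k = 1).
Proof.
move=> H kp; have [Sd _] := extS H kp; have [Sm _] := extS (fence_pair_sym H) kp.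
have ok := fp_odd H kp.
have [Ek|ltkp] : k = p \/ k < p by lia.
  rewrite Ek in Sd Sm ok *.
  rewrite !ext_out !ext_in // in Sd Sm.
  by have := fp_d_le H; have := fp_m_le H; lia.
have kp' : 0 < k < p by lia.
have aj := fp_adj H kp'; have okS : odd (d k.+1) = odd (m k.+1) by apply: (fp_odd H); lia.
by rewrite !ext_in in Sd Sm; lia.
Qed.

(** * The intermediate points c_k *)

Definition upart (n p : nat) (d m : nat -> nat) : seq letter :=
  ublock (ext n p d) (defect n p d m) 1 p.

Definition center (n p : nat) (d m : nat -> nat) (k : nat) : nat :=
  ext n p d k + shift (defect n p d m) k (p.+1 - k).

Section Core.
Context (n p : nat) (d m : nat -> nat) (H : fence_pair n p d m).

Local Notation d' := (ext n p d).
Local Notation ju := (defect n p d m).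
Local Notation c := (center n p d m).
Local Notation up := (upart n p d m).

(** Descending induction from the common sentinel: since corresponding gaps have equal parity, each
    step subtracts the minimum of the two gaps. *)
Lemma center_sym k : 0 < k <= p.+1 -> c k = center n p m d k.
Proof.
move=> kp; have [l El] : exists l, l = p.+1 - k by eexists.
elim: l k kp El => [|l IH] k kp El.
  have -> : k = p.+1 by lia.
  by rewrite /center !ext_out subnn.
have kp' : 0 < k <= p by lia.
have kp1 : k <= p by lia.
have := IH k.+1; rewrite /center !(shiftS _ kp1).
have [Sd _] := extS H kp'; have [Sm _] := extS (fence_pair_sym H) kp'.
have [par _] := gap_parity H kp'.
by rewrite /defect Sd Sm; lia.
Qed.

Lemma center_inc k : 0 < k <= p -> c k < c k.+1.
Proof.
move=> kp; rewrite /center shiftS; last by lia.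
have [Sd Dg] := extS H kp; have [Sm Mg] := extS (fence_pair_sym H) kp.
by rewrite /defect Sd; lia.
Qed.

Lemma center_homo a b : 0 < a -> a <= b -> b <= p.+1 -> c a <= c b.
Proof.
move=> a0 ab bp.
by apply: (@ublock_homo c 1 p) => [r rp||//|]; [apply: center_inc|..]; lia.
Qed.

Lemma ext_inc r : 1 <= r < 1 + p -> d' r < d' r.+1.
Proof. by move=> rp; have := extS H (k := r); lia. Qed.

(** When the defect is positive, the [d]-gap minus twice the defect is the [m]-gap. The latter is
    not 1, since otherwise both gaps would be 1. *)
Lemma ext_gap r : 1 <= r < 1 + p -> 0 < ju r -> d' r + 2 * ju r + 2 <= d' r.+1.
Proof.
move=> rp; have rp' : 0 < r <= p by lia.
have [Sd _] := extS H rp'; have [_ M0] := extS (fence_pair_sym H) rp'.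
have [par one] := gap_parity H rp'.
by rewrite /defect Sd; lia.
Qed.

Lemma act_up_dom k : 0 < k <= p -> act up (d' k) = Some (c k).
Proof.
move=> kp; have [->|k1] : k = 1 \/ 1 < k by lia.
  have := act_ublock_low ext_inc ext_gap (leqnn 1) (leqnn (1 + p)) (leqnn (d' 1)).
  by rewrite /center subSS subn0.
(* For [k > 1] the point is handled as the right end of gap [k - 1], which [ext_gap] keeps out of
   the hole. *)
have -> : k = k.-1.+1 by lia.
rewrite (act_ublock_gap ext_inc ext_gap (leqnn 1) (leqnn (1 + p)) (r := k.-1)).
- have gk := ext_gap (r := k.-1); rewrite ifF; last by lia.
  by rewrite /center add1n.
- by lia.
- by have := ext_inc (r := k.-1); lia.
Qed.

Lemma act_up_low x : x <= d' 1 -> act up x = Some (x + shift ju 1 p).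
Proof. by move=> x1; apply: (act_ublock_low ext_inc ext_gap (k := 1) (l := p)). Qed.

Lemma act_up_gap k x : 0 < k <= p -> d' k < x <= d' k.+1 ->
  act up x = if (0 < ju k) && (x < d' k + 2 * ju k + 2) then None
             else Some (x + shift ju k.+1 (p.+1 - k.+1)).
Proof.
move=> kp xk.
by rewrite (act_ublock_gap ext_inc ext_gap (leqnn 1) (leqnn (1 + p)) (r := k)) //; lia.
Qed.

Lemma act_up_gap_center k x z : 0 < k <= p -> d' k < x <= d' k.+1 ->
  act up x = Some z ->
  [/\ c k + (if 0 < ju k then 2 else 1) <= z <= c k.+1,
      z = x + shift ju k.+1 (p.+1 - k.+1) &
      0 < ju k -> d' k + 2 * ju k + 2 <= x].
Proof.
move=> kp xk; rewrite (act_up_gap kp xk) /center (@shiftS _ k); last by lia.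
case E: (_ && _) => //= -[<-].
by split=> // [|j0]; [case: ifP => j0|]; move: E; rewrite ?j0 /=; lia.
Qed.

End Core.

(** * Factorisation of w* into the two families of words *)

Lemma mem_Wu n i j : 0 < i -> 0 < j -> i + 2 * j <= n -> uword i j \in Wu n.
Proof.
by move=> i0 j0 ij; apply/allpairsPdep; exists i, j; rewrite !mem_iota; split=> //; lia.
Qed.

Lemma mem_Wx n i j : 0 < i -> 0 < j -> i + 2 * j <= n -> xword i j \in Wx n.
Proof.
by move=> i0 j0 ij; apply/allpairsPdep; exists i, j; rewrite !mem_iota; split=> //; lia.
Qed.

(** The first letter separates W_u from W_x and excludes the empty word from both. *)
Lemma Wu_head n w : w \in Wu n -> exists i s, w = U i :: s.
Proof.
case/allpairsPdep=> i [j []]; rewrite !mem_iota => _ + ->.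
by case: j => // j _; exists i, (uword i.+2 j); rewrite uwordS.
Qed.

Lemma xwordE i j : xword i j = map inv_letter (uword i j).
Proof. by rewrite /xword /uword -map_comp. Qed.

Lemma Wx_head n w : w \in Wx n -> exists i s, w = X i :: s.
Proof.
case/allpairsPdep=> i [j []]; rewrite !mem_iota => _ + ->.
by case: j => // j _; exists i, (xword i.+2 j); rewrite !xwordE uwordS.
Qed.

Lemma xword_notin_Wu n i j : xword i j \in Wu n = false.
Proof. by apply/negP => /Wu_head [k [s]]; case: j. Qed.

Lemma uword_notin_Wx n i j : uword i j \in Wx n = false.
Proof. by apply/negP => /Wx_head [k [s]]; case: j. Qed.

(** Both selections, of the breaks and of the words of one kind, are absorbed by letting discarded
    indices contribute the empty word. *)
Lemma flatten_filter_map (T : eqType) (I : eqType) (P : pred I) (Q : pred (seq T))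
    (f g : I -> seq T) (s : seq I) :
  {in s, forall i, (if P i && Q (f i) then f i else [::]) = g i} ->
  flatten [seq w <- map f (filter P s) | Q w] = flatten (map g s).
Proof.
elim: s => //= i s IH Hs; have := Hs i (mem_head _ _).
have {}IH := IH (fun k ks => Hs k (mem_behead (s := i :: s) ks)).
case: (P i) => /= [|<-]; last by rewrite IH.
by case: (Q (f i)) => /= <-; rewrite IH.
Qed.

Lemma fp_mono n p d m a b : fence_pair n p d m ->
  0 < a -> a <= b -> b <= p -> d a <= d b.
Proof.
move=> H a0 ab bp; rewrite -(@ext_in n p d a) -?(@ext_in n p d b) //; last by lia.
by apply: (ublock_homo (ext_inc H)); lia.
Qed.

Lemma fp_bounds n p d m k : fence_pair n p d m -> 0 < k <= p -> 0 < d k <= n.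
Proof.
move=> H kp; have := fp_mono H (a := 1) (b := k); have := fp_mono H (a := k) (b := p).
by have := fp_d_gt0 H; have := fp_d_le H; lia.
Qed.

Lemma gap_lt n p d k : k < p -> gap n p d k = d k.+1 - d k.
Proof. by move=> kp; rewrite /gap !ext_in //; lia. Qed.

Lemma defect_last n p d m : fence_pair n p d m -> defect n p d m p = (m p - d p) %/ 2.
Proof.
move=> H; rewrite /defect /gap !ext_out !ext_in //.
by have := fp_d_le H; have := fp_m_le H; lia.
Qed.

Lemma defect_le n p d m k : fence_pair n p d m -> 0 < k <= p ->
  0 < defect n p d m k -> d k + 2 * defect n p d m k <= n.
Proof.
move=> H kp; have := fp_bounds H kp.
have [->|ltkp] : k = p \/ k < p by lia.
  by rewrite defect_last //; have := fp_m_le H; lia.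
rewrite /defect !gap_lt //; have := fp_bounds H (k := k.+1); lia.
Qed.

Lemma bracket (f : nat -> nat) q x : f 1 < x <= f q.+1 ->
  exists2 k, 0 < k <= q & f k < x <= f k.+1.
Proof.
elim: q => [|q IH] xq; first by lia.
have [xfq|fqx] := leqP x (f q.+1); last by exists q.+1; lia.
by have [k kq xk] := IH ltac:(lia); exists k; first lia.
Qed.

Section Words.
Context (n p : nat) (d m : nat -> nat) (H : fence_pair n p d m).

Let H' := fence_pair_sym H.

Lemma iota_rcons : iota 1 p = rcons (iota 1 p.-1) p.
Proof.
have p0 := fp_p_gt0 H; rewrite -cats1.
have {1}-> : p = p.-1 + 1 by lia.
by rewrite iotaD /= add1n prednK.
Qed.

(** By parity, unequal gaps differ by at least 2, so comparing them amounts to testing which defect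
    is positive. *)
Lemma wbreakE k : 0 < k < p ->
  wbreak d m k = if 0 < defect n p m d k then xword (m k) (defect n p m d k)
                 else uword (d k) (defect n p d m k).
Proof.
move=> kp; rewrite /wbreak /defect !gap_lt; try lia.
have [par _] := gap_parity H (k := k) ltac:(lia); rewrite !gap_lt in par; try lia.
by congr (if _ then _ else _); lia.
Qed.

Lemma wlastE :
  wlast p d m = if 0 < defect n p m d p then xword (m p) (defect n p m d p)
                else uword (d p) (defect n p d m p).
Proof.
have p0 := fp_p_gt0 H; have op := fp_odd H (k := p) ltac:(lia).
rewrite /wlast (defect_last H) (defect_last H'); case: ltnP => dm.
  by rewrite ifT //; lia.
have -> : (0 < (d p - m p) %/ 2) = false by lia.
by case: ifP => // ?; have -> : m p - d p = 0 by lia.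
Qed.

Lemma breaksE k : 0 < k < p ->
  (d k.+1 - d k != m k.+1 - m k) = (0 < defect n p d m k) || (0 < defect n p m d k).
Proof.
move=> kp; rewrite /defect !gap_lt; try lia.
have [par _] := gap_parity H (k := k) ltac:(lia); rewrite !gap_lt in par; try lia.
Qed.

Lemma Wu_if k : 0 < k <= p ->
  (if 0 < defect n p m d k then xword (m k) (defect n p m d k)
   else uword (d k) (defect n p d m k)) \in Wu n = (0 < defect n p d m k).
Proof.
move=> kp; case: ifP => jx.
  by rewrite xword_notin_Wu; move: jx; rewrite /defect; lia.
case: (posnP (defect n p d m k)) => [->|j0].
  by apply/negP => /Wu_head [i [s]].
by rewrite mem_Wu //; [have := fp_bounds H kp; lia|apply: (defect_le H)].
Qed.

Lemma Wx_if k : 0 < k <= p ->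
  (if 0 < defect n p m d k then xword (m k) (defect n p m d k)
   else uword (d k) (defect n p d m k)) \in Wx n = (0 < defect n p m d k).
Proof.
move=> kp; case: ifP => [j0|jx]; last by rewrite uword_notin_Wx.
by rewrite mem_Wx //; [have := fp_bounds H' kp; lia|apply: (defect_le H')].
Qed.

Lemma wlist_Wu : flatten [seq w <- wlist p d m | w \in Wu n] = upart n p d m.
Proof.
have p0 := fp_p_gt0 H.
rewrite /wlist -cats1 filter_cat flatten_cat.
rewrite (@flatten_filter_map _ _ _ _ _
  (fun k => uword (ext n p d k) (defect n p d m k))); last first.
  move=> k; rewrite mem_iota => kp.
  rewrite breaksE ?wbreakE ?Wu_if ?ext_in; try lia.
  case: (posnP (defect n p d m k)) => [->|j0]; first by rewrite andbF.
  by rewrite ifF //; move: j0; rewrite /defect; lia.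
rewrite /upart /ublock iota_rcons -cats1 map_cat flatten_cat /=; congr (_ ++ _).
rewrite wlastE Wu_if ?ext_in //; last by lia.
case: (posnP (defect n p d m p)) => [->|j0] //=.
by rewrite ifF //; move: j0; rewrite /defect; lia.
Qed.

Lemma wlist_Wx :
  flatten [seq w <- wlist p d m | w \in Wx n] = map inv_letter (upart n p m d).
Proof.
have p0 := fp_p_gt0 H.
rewrite /wlist -cats1 filter_cat flatten_cat.
rewrite (@flatten_filter_map _ _ _ _ _
  (fun k => xword (ext n p m k) (defect n p m d k))); last first.
  move=> k; rewrite mem_iota => kp.
  rewrite breaksE ?wbreakE ?Wx_if ?ext_in; try lia.
  by case: (posnP (defect n p m d k)) => [->|j0]; rewrite ?andbF ?orbT.
rewrite /upart /ublock map_flatten -map_comp.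
rewrite (eq_map (g := fun k => xword (ext n p m k) (defect n p m d k))); last first.
  by move=> k; rewrite /= xwordE.
rewrite iota_rcons -cats1 map_cat flatten_cat /=; congr (_ ++ _).
rewrite wlastE Wx_if ?ext_in //; last by lia.
by case: (posnP (defect n p m d p)) => [->|j0].
Qed.

(** Listing the x-words decreasingly and reversing each one is the same as reversing their
    concatenation. *)
Lemma wstarE :
  wstar n p d m = upart n p d m ++ rev (map inv_letter (upart n p m d)).
Proof. by rewrite /wstar wlist_Wu -wlist_Wx map_rev rev_flatten. Qed.

Lemma act_wstar x y : 0 < x -> 0 < y ->
  act (wstar n p d m) x = Some y <->
  exists z, act (upart n p d m) x = Some z /\ act (upart n p m d) y = Some z.
Proof.
move=> x0 y0; rewrite wstarE act_cat; split.
  case Ez: (act (upart n p d m) x) => [z|] //= Ey; exists z; split=> //.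
  by apply/(act_inv _ y0) => //; apply: act_gt0 Ez.
by case=> z [Ez Ey]; rewrite Ez /=; apply/act_inv => //; apply: act_gt0 Ez.
Qed.

Lemma act_wstar_dom k : 0 < k <= p -> act (wstar n p d m) (d k) = Some (m k).
Proof.
move=> kp; have dk := fp_bounds H kp; have mk := fp_bounds H' kp.
apply/act_wstar; try lia.
have kp' : k <= p by lia.
(* Both halves meet at c_k, by the symmetry of [center]. *)
exists (center n p d m k); split.
  by rewrite -{1}(@ext_in n p d k) // (act_up_dom H).
by rewrite -{1}(@ext_in n p m k) // (act_up_dom H') // (center_sym H) //; lia.
Qed.

Lemma gap_index x : d 1 < x <= n ->
  exists2 k, 0 < k <= p & ext n p d k < x <= ext n p d k.+1.
Proof.
move=> x1; have p0 := fp_p_gt0 H.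
by apply: bracket; rewrite ext_out ext_in; lia.
Qed.

End Words.

Lemma center1 n p d m : fence_pair n p d m ->
  center n p d m 1 = d 1 + shift (defect n p d m) 1 p.
Proof. by move=> H; rewrite /center ext_in ?(fp_p_gt0 H) // subSS subn0. Qed.

(** * The points deleted by the letters v *)

Section Prefix.
Context (n p : nat) (d m : nat -> nat) (H : fence_pair n p d m).

Let H' := fence_pair_sym H.

(** The common image is at most c_1, which forces [y <= m 1]; then both halves are translations,
    sending [d 1] and [m 1] to c_1. *)
Lemma act_wstar_low x y : 0 < x <= d 1 -> 0 < y <= n ->
  act (wstar n p d m) x = Some y -> x + m 1 = y + d 1.
Proof.
move=> x1 yn /(act_wstar H) []; try lia; move=> z [].
have p0 := fp_p_gt0 H; have Cd := center1 H; have Cm := center1 H'.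
rewrite -(center_sym H) in Cm; last by lia.
rewrite (act_up_low H); last by rewrite ext_in; lia.
case=> <-; have [y1|y1] := leqP y (m 1).
  by rewrite (act_up_low H') ?ext_in // => -[]; lia.
have [k kp yk] := gap_index H' (x := y) ltac:(lia).
case/(act_up_gap_center H' kp yk); rewrite -(center_sym H); last by lia.
by have := center_homo H (a := 1) (b := k); case: ifP => _; lia.
Qed.

(** If the [d]-gap is longer, the u-word of gap [k] deletes the lower points. If the [m]-gap is
    longer, the hole of the [m]-side forces the common image to be at least c_k + 2, while [x] keeps
    its distance from the left end. *)
Lemma act_wstar_gap k x y : 0 < k <= p -> ext n p d k < x < ext n p d k.+1 ->
  0 < y <= n -> act (wstar n p d m) x = Some y ->
  [\/ gap n p d k = gap n p m k,
      gap n p m k < gap n p d k /\ ext n p d k.+1 <= x + (gap n p m k - 2) |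
      gap n p d k < gap n p m k /\ ext n p d k + 2 <= x].
Proof.
move=> kp xk yn /(act_wstar H) []; try lia; move=> z [].
have xk' : ext n p d k < x <= ext n p d k.+1 by lia.
case/(act_up_gap_center H kp xk') => zk Ez xu.
have [Sd Dg] := extS H kp; have [Sm Mg] := extS H' kp.
have [par one] := gap_parity H kp.
have p0 := fp_p_gt0 H; have Cm := center1 H'.
rewrite -(center_sym H) in Cm; last by lia.
have [y1|y1] := leqP y (m 1).
  rewrite (act_up_low H'); last (by rewrite ext_in); move=> -[] Ez'.
  by have := center_homo H (a := 1) (b := k); case: ifP zk; lia.
have [r rp yr] := gap_index H' (x := y) ltac:(lia).
case/(act_up_gap_center H' rp yr); rewrite -!(center_sym H); try lia.
move=> zr Ez' _.
(* The intervals from c_k (excluded) to c_(k+1) are disjoint, so the common image determines the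
   gap. *)
have Er : r = k.
  have := center_homo H (a := r.+1) (b := k).
  have := center_homo H (a := k.+1) (b := r).
  by case: ifP zr; case: ifP zk; lia.
rewrite {}Er in rp yr zr Ez'.
have [?|[MD|DM]] : gap n p d k = gap n p m k \/ gap n p m k < gap n p d k \/
  gap n p d k < gap n p m k by lia.
- by constructor 1.
- by constructor 2; split=> //; move: xu; rewrite /defect; lia.
constructor 3; split=> //.
have : 0 < defect n p m d k by rewrite /defect; lia.
move=> j0; rewrite j0 in zr.
have Ec' : center n p d m k = ext n p d k + 2 * defect n p d m k +
   shift (defect n p d m) k.+1 (p.+1 - k.+1) by rewrite /center (@shiftS _ k); lia.
have j0' : defect n p d m k = 0 by rewrite /defect; lia.
by lia.
Qed.

Lemma mem_vrange i j x : (V x \in vrange i j) = (i <= x <= j).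
Proof.
rewrite /vrange mem_map => [|a b []] //.
by rewrite mem_index_iota ltnS.
Qed.

Definition V_only (w : seq letter) := {in w, forall l, exists i, l = V i}.

Lemma V_only_vrange i j : V_only (vrange i j).
Proof. by move=> l /mapP [k _ ->]; exists k. Qed.

Lemma V_only_cat w1 w2 : V_only w1 -> V_only w2 -> V_only (w1 ++ w2).
Proof. by move=> h1 h2 l; rewrite mem_cat => /orP []; auto. Qed.

(** Boolean form of the conclusion of [act_wstar_gap], to be matched with the ranges of letters v;
    at [k = p] it describes the points above d_p. *)
Definition filled (k x : nat) : bool :=
  (ext n p d k < x < ext n p d k.+1) &&
  [|| gap n p d k == gap n p m k,
      (gap n p m k < gap n p d k) && (ext n p d k.+1 <= x + (gap n p m k - 2)) |
      (gap n p d k < gap n p m k) && (ext n p d k + 2 <= x)].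

(** Where the construction adds no letter, the shorter gap is 2, or both gaps are 1, and [filled]
    holds nowhere. *)
Lemma gap_prefixP k : 0 < k < p -> V_only (gap_prefix d m k.+1) /\
  forall x, (V x \in gap_prefix d m k.+1) = filled k x.
Proof.
move=> kp; split=> [|x].
  by rewrite /gap_prefix; do ![case: ifP => _]; try exact: V_only_vrange.
have [Sd Dg] := extS H (k := k) ltac:(lia); have [Sm Mg] := extS H' (k := k) ltac:(lia).
have [par one] := gap_parity H (k := k) ltac:(lia).
rewrite /filled !ext_in in Sd Sm *; try lia.
rewrite /gap_prefix -!(@gap_lt n p) /=; try lia.
do ![case: ifP => ?]; rewrite ?mem_vrange ?in_nil; lia.
Qed.

Lemma lambda0P : exists pre, [/\ lambda0 n p d m = pre ++ wstar n p d m, V_only pre &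
  forall x, (V x \in pre) = (x <= n) && filled p x].
Proof.
have p0 := fp_p_gt0 H; have pp : 0 < p <= p by lia.
have dn := fp_bounds H pp; have mn := fp_bounds H' pp; have op := fp_odd H pp.
(* The sentinels cancel: a longer last [d]-gap means [d p < m p], and its lower bound becomes
   [m p + 2]. *)
have fE x : filled p x = (d p < x < n.+2) &&
  [|| d p == m p, (d p < m p) && (m p + 2 <= x) | (m p < d p) && (d p + 2 <= x)].
  rewrite /filled /gap !ext_out !ext_in //; lia.
rewrite /lambda0; do ![case: ifP => ?].
- exists (vrange (d p + 2) n); split=> // [|x]; first exact: V_only_vrange.
  by rewrite mem_vrange fE; lia.
- exists (vrange (m p + 2) n); split=> // [|x]; first exact: V_only_vrange.
  by rewrite mem_vrange fE; lia.
- exists (vrange (m p + 1) n); split=> // [|x]; first exact: V_only_vrange.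
  by rewrite mem_vrange fE; lia.
- exists [:: V n]; split=> // [l|x]; first by rewrite inE => /eqP ->; exists n.
  rewrite fE inE; have -> : (V x == V n) = (x == n) by apply/eqP/eqP => [[]|->].
  by lia.
exists [::]; split=> // x; rewrite fE in_nil; lia.
Qed.

Lemma lambdaP t : t < p ->
  exists pre, [/\ lambda n p d m t = pre ++ wstar n p d m, V_only pre &
  forall x, V x \in pre <-> x <= n /\ exists2 k, p - t <= k <= p & filled k x].
Proof.
elim: t => [|t IH] tp.
  have [pre [E Vp Hp]] := lambda0P; exists pre; split=> // x; rewrite Hp subn0; split.
    by case/andP=> xn xf; split=> //; exists p; lia.
  case=> xn [k kp xf]; have <- : k = p by lia.
  by rewrite xn.
have [pre [E Vp Hp]] := IH (ltnW tp).
have [k Ek] : exists k, p - t = k.+1 by exists (p - t.+1); lia.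
have kp : 0 < k < p by lia.
have [Vg Hg] := gap_prefixP kp.
exists (gap_prefix d m (p - t) ++ pre); rewrite /= E Ek catA; split=> //.
  exact: V_only_cat.
move=> x; rewrite mem_cat Hg; split.
  case/orP=> [xf|/Hp [xn [r rp xf]]]; split=> //; [|exists k| exists r] => //; try lia.
  have := xf; rewrite /filled !ext_in; try lia.
  have := fp_bounds H (k := k.+1); lia.
case=> xn [r rp xf]; have [<-|rk] : r = k \/ k < r by lia.
  by rewrite xf.
by apply/orP; right; apply/Hp; split=> //; exists r; lia.
Qed.

Lemma lambda_lastP :
  exists pre, [/\ lambda_last n p d m = pre ++ wstar n p d m, V_only pre &
  forall x, V x \in pre <-> [\/ [/\ 0 < x < d 1, 1 < m 1 & d 1 < x + m 1] |
     x <= n /\ exists2 k, 0 < k <= p & filled k x]].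
Proof.
have p0 := fp_p_gt0 H; have d0 := fp_d_gt0 H; have m0 := fp_m_gt0 H.
have [pre [E Vp Hp]] := @lambdaP p.-1 ltac:(lia).
have E1 : p - p.-1 = 1 by lia.
rewrite E1 in Hp.
(* Below [d 1], the letters are those [x] whose translate [x + m 1 - d 1] is positive. *)
have [Vf Hf] : V_only (first_prefix d m) /\ forall x, (V x \in first_prefix d m) =
    [&& 0 < x < d 1, 1 < m 1 & d 1 < x + m 1].
  split=> [|x]; rewrite /first_prefix; do ![case: ifP => ?];
  rewrite ?mem_vrange ?in_nil; try exact: V_only_vrange; try by []; lia.
exists (first_prefix d m ++ pre); rewrite /lambda_last E catA; split=> //.
  exact: V_only_cat.
move=> x; rewrite mem_cat Hf; split.
  by case/orP=> [/and3P ?|/Hp ?]; [constructor 1|constructor 2].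
by case=> [/and3P ->//|?]; apply/orP; right; apply/Hp.
Qed.

Lemma act_lambda_last_dom k : 0 < k <= p -> act (lambda_last n p d m) (d k) = Some (m k).
Proof.
move=> kp; have [pre [-> Vp Hp]] := lambda_lastP.
rewrite act_V // (act_wstar_dom H kp); case: ifP => // /Hp [[]|[_ [r rp]]].
  by have := fp_mono H (a := 1) (b := k); lia.
(* No [d k] lies strictly inside a gap. *)
case/andP; rewrite -(@ext_in n p d k); last by lia.
have := ublock_homo (ext_inc H) (a := r.+1) (b := k).
have := ublock_homo (ext_inc H) (a := k) (b := r); lia.
Qed.

(** A point outside the domain that w* still sends into the range 1 to [n] lies below [d 1] or
    strictly inside a gap, and is then one of the deleted points. *)
Lemma act_lambda_last_sub x y : 0 < x <= n -> 0 < y <= n ->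
  act (lambda_last n p d m) x = Some y -> exists2 k, 0 < k <= p & d k = x.
Proof.
move=> xn yn; have [pre [-> Vp Hp]] := lambda_lastP; have p0 := fp_p_gt0 H.
rewrite act_V //; case: ifP => // /negP xpre Ey.
have [[k kp Ek]|nx] : (exists2 k, 0 < k <= p & d k = x) \/
    (forall k, 0 < k <= p -> d k != x).
- case: (boolP (has (fun k => d k == x) (iota 1 p))) => [/hasP [k]|/hasPn nx].
    by rewrite mem_iota => kp /eqP; left; exists k.
  by right=> k kp; apply: nx; rewrite mem_iota.
- by exists k.
case: xpre; apply/Hp; have nx1 := nx 1 ltac:(lia).
have [x1|x1] := leqP x (d 1).
  by constructor 1; have := act_wstar_low (x := x) ltac:(lia) yn Ey; split; lia.
have [k kp xk] := gap_index H (x := x) ltac:(lia).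
have xk' : ext n p d k < x < ext n p d k.+1.
  have [Ekp|ltkp] : k = p \/ k < p by lia.
    by rewrite Ekp ext_out ext_in // in xk *; lia.
  by have := nx k.+1; rewrite !ext_in // in xk *; lia.
constructor 2; split; first by lia.
exists k => //; rewrite /filled xk' /=.
by case: (act_wstar_gap kp xk' yn Ey); lia.
Qed.

(** * Membership of the letters in the alphabet *)

Lemma uword_alphabet i j : 0 < i -> i + 2 * j <= n -> all (alphabet n) (uword i j).
Proof.
move=> i0 ij; apply/allP => l /mapP [t]; rewrite mem_iota => tj -> /=; lia.
Qed.

Lemma alphabet_inv w : all (alphabet n) (map inv_letter w) = all (alphabet n) w.
Proof. by rewrite all_map; apply: eq_all => -[]. Qed.

End Prefix.

Lemma upart_alphabet n p d m : fence_pair n p d m -> all (alphabet n) (upart n p d m).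
Proof.
move=> H; apply/allP => l /flatten_mapP [k]; rewrite mem_iota => kp.
case: (posnP (defect n p d m k)) => [-> //|j0].
rewrite ext_in; last by lia.
move: l; apply/allP/uword_alphabet; first by have := fp_bounds H (k := k); lia.
by apply: (defect_le H) => //; lia.
Qed.

Lemma lambda_last_alphabet n p d m : fence_pair n p d m ->
  all (alphabet n) (lambda_last n p d m).
Proof.
move=> H; have [pre [-> Vp Hp]] := lambda_lastP H.
rewrite (wstarE H) !all_cat all_rev alphabet_inv !upart_alphabet ?andbT //; last first.
  exact: fence_pair_sym.
have p0 := fp_p_gt0 H; have d1 := fp_bounds H (k := 1) ltac:(lia).
apply/allP => l lpre; have [x Ex] := Vp l lpre; rewrite {}Ex in lpre *.
move/Hp: lpre => /= [[]|[xn [k kp /andP [xk _]]]]; lia.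
Qed.

(** * From the partial transformation to its numerical sequences *)

Section Graph.
Context (n : nat) (a : ptrans n).

Local Notation p := (size (graph a)).
Local Notation d := (fun k => nth 0 (unzip1 (graph a)) k.-1).
Local Notation m := (fun k => nth 0 (unzip2 (graph a)) k.-1).

Lemma mem_graph u : u \in graph a ->
  exists x y, [/\ a x = Some y, u.1 = lbl x & u.2 = lbl y].
Proof.
rewrite /graph mem_pmap => /mapP [x _].
by case E: (a x) => [y|] //= [->]; exists x, y.
Qed.

Lemma graph_mem x y : a x = Some y -> (lbl x, lbl y) \in graph a.
Proof.
move=> E; rewrite /graph mem_pmap; apply/mapP; exists x; rewrite ?mem_enum //.
by rewrite E.
Qed.

Lemma graph_sorted : sorted ltn (unzip1 (graph a)).
Proof.
have -> : unzip1 (graph a) = map (@lbl n) (filter (fun x => isSome (a x)) (enum 'I_n)).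
  by rewrite /graph; elim: (enum 'I_n) => //= x s IH; case: (a x) => [y|] //=; rewrite IH.
rewrite sorted_map; apply: sorted_filter; first by move=> y x z; apply: ltn_trans.
have : sorted ltn (map val (enum 'I_n)) by rewrite val_enum_ord iota_ltn_sorted.
by rewrite sorted_map.
Qed.

Lemma graph_nth k : 0 < k <= p ->
  exists x y, [/\ a x = Some y, d k = lbl x & m k = lbl y].
Proof.
move=> kp; have kp' : k.-1 < p by lia.
have [x [y [E Ex Ey]]] := mem_graph (mem_nth (0, 0) kp').
by exists x, y; rewrite /unzip1 /unzip2 !(nth_map (0, 0)).
Qed.

Lemma graph_index x y : a x = Some y ->
  exists k, [/\ 0 < k <= p, d k = lbl x & m k = lbl y].
Proof.
move=> /graph_mem xy; have ip := xy; rewrite -index_mem in ip.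
exists (index (lbl x, lbl y) (graph a)).+1.
by rewrite /unzip1 /unzip2 !(nth_map (0, 0)) //= nth_index.
Qed.

Lemma graph_fence_pair : IOFpar a -> a <> pempty n -> fence_pair n p d m.
Proof.
case=> [[inj fp] [b [injb fpb] aba] op pp] ne.
(* The regularity witness inverts [a] on its image, by injectivity of [a]. *)
have ba x y : a x = Some y -> b y = Some x.
  move=> E; have := congr1 (fun f : ptrans n => f x) aba.
  rewrite /pcomp !ffunE E /=; case Eb: (b y) => [z|] //= Ez.
  by rewrite (inj _ _ _ Ez E).
have p0 : 0 < p.
  rewrite lt0n; apply/eqP => p0; apply: ne; apply/ffunP => x; rewrite ffunE.
  by case E: (a x) => [y|] //; have [k []] := graph_index E; lia.
have dS k : 0 < k < p -> d k < d k.+1.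
  move=> kp; have /(sortedP 0)/(_ k.-1) := graph_sorted; rewrite size_map.
  by rewrite prednK; [apply|]; lia.
have lb (x : 'I_n) : 0 < lbl x <= n by apply: ltn_ord.
split=> //.
- by have [x [y [_ -> _]]] := graph_nth (k := 1) ltac:(lia); have := lb x; lia.
- by have [x [y [_ _ ->]]] := graph_nth (k := 1) ltac:(lia); have := lb y; lia.
- by have [x [y [_ -> _]]] := graph_nth (k := p) ltac:(lia); have := lb x; lia.
- by have [x [y [_ _ ->]]] := graph_nth (k := p) ltac:(lia); have := lb y; lia.
- move=> k kp; have := dS k kp.
  have [x [y [E -> ->]]] := graph_nth (k := k) ltac:(lia).
  have [x' [y' [E' -> ->]]] := graph_nth (k := k.+1) ltac:(lia).
  exact: op E E'.
- move=> k kp; have [x [y [E -> ->]]] := graph_nth kp; exact: pp.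
move=> k kp; have := dS k kp.
have [x [y [E -> ->]]] := graph_nth (k := k) ltac:(lia).
have [x' [y' [E' -> ->]]] := graph_nth (k := k.+1) ltac:(lia).
move=> xx'; have yy' := op _ _ _ _ E E' xx'.
(* Either point of an adjacent pair may be the odd one, so fence preservation by [a] and by [b] is
   used in both orders. *)
have h1 := fp _ _ _ _ E E'; have h2 := fp _ _ _ _ E' E.
have h3 := fpb _ _ _ _ (ba _ _ E) (ba _ _ E').
have h4 := fpb _ _ _ _ (ba _ _ E') (ba _ _ E).
move: h1 h2 h3 h4; rewrite /fence; move: (lbl x) (lbl x') (lbl y) (lbl y') xx' yy'; lia.
Qed.

End Graph.

(** * Equality of the map and the value of its word *)

Theorem theorem1 (n : nat) (hn : 4 <= n) (a : ptrans n) (ha : IOFpar a)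
    (hid : ~ partial_identity a) (hne : a <> pempty n) :
  all (alphabet n) (w_word a) /\ a = word_bar n (w_word a).
Proof.
have H := graph_fence_pair ha hne.
have alph : all (alphabet n) (w_word a) by apply: lambda_last_alphabet H.
split=> //; apply/ffunP => x; apply: omap_lbl_inj; rewrite word_barE //.
have lb (z : 'I_n) : 0 < lbl z <= n by apply: ltn_ord.
case E: (a x) => [y|] /=.
  have [k [kp <- <-]] := graph_index E.
  by rewrite (act_lambda_last_dom H kp).
(* Outside the domain of [a], a value of the word at [x] would make [x] one of the d_k, hence a
   point of the domain. *)
have := word_barE x alph.
case Ew: (word_bar n (w_word a) x) => [y|] //= Ey.
have [k kp dk] := act_lambda_last_sub H (lb x) (lb y) (esym Ey).
have [x' [y' [E' Ex' _]]] := graph_nth kp.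
suff Exx : x' = x by rewrite Exx E in E'.
by apply: val_inj; move: Ex'; rewrite dk => -[].
Qed.
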